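(* Let $X$ and $Y$ be Banach spaces (over the same field, $\mathbb{R}$ or $\mathbb{C}$) and let $T,S:X\to Y$ be bounded linear operators such that $\ker(S)\subseteq \ker(T)$. Let $\pi:X\to X/\ker(S)$, $\pi(x):=x+\ker(S)$, denote the quotient map. Then $$\operatorname*{arg\,max}_{\|S(x)\|\leq 1}\|T(x)\|=\pi^{-1}\left( \operatorname*{arg\,max}_{\|\overline{S}(\pi(x))\|\leq 1}\|\overline{T}(\pi(x))\|\right),$$ where $\overline{T}:X/\ker(S)\to Y$ is given by $\overline{T}(\pi(x)):=T(x)$ and $\overline{S}:X/\ker(S)\to Y$ is given by $\overline{S}(\pi(x)):=S(x)$.
   Context: $\operatorname*{arg\,max}_{\|S(x)\|\leq 1}\|T(x)\|$ is the (possibly empty) set of all $x_0\in X$ with $\|S(x_0)\|\leq 1$ such that $\|T(x_0)\|\geq \|T(x)\|$ for all $x\in X$ with $\|S(x)\|\leq 1$. Likewise, $\operatorname*{arg\,max}_{\|\overline{S}(\pi(x))\|\leq 1}\|\overline{T}(\pi(x))\|$ is the set of all elements $\xi_0\in X/\ker(S)$ with $\|\overline{S}(\xi_0)\|\leq 1$ such that $\|\overline{T}(\xi_0)\|\geq\|\overline{T}(\xi)\|$ for all $\xi\in X/\ker(S)$ with $\|\overline{S}(\xi)\|\leq 1$. The notation $\pi^{-1}(\cdot)$ denotes the preimage of a set under $\pi$. *)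

(* Defs.v *)
From HB Require Import structures.
From mathcomp Require Import all_boot all_order all_algebra.
From mathcomp Require Import all_classical all_reals all_analysis.

Set Implicit Arguments.
Unset Strict Implicit.
Unset Printing Implicit Defensive.

Import Order.TTheory GRing.Theory Num.Theory.
Import numFieldNormedType.Exports.

Local Open Scope classical_set_scope.
Local Open Scope quotient_scope.
Local Open Scope ring_scope.

Definition ker (K : pzRingType) (U V : lmodType K) (f : {linear U -> V}) :
  {pred U} := fun x => f x == 0.

Section Kernel.
Context (K : pzRingType) (U V : lmodType K) (f : {linear U -> V}).

Lemma kerE x : (x \in ker f) = (f x == 0). Proof. by []. Qed.

Lemma ker_submod_closed : submod_closed (ker f).
Proof.
split=> [|a u v]; rewrite !kerE ?linear0 // => /eqP fu /eqP fv.
by rewrite linearP fu fv scaler0 addr0.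
Qed.

HB.instance Definition _ :=
  GRing.isSubmodClosed.Build K U (ker f) ker_submod_closed.

End Kernel.

(* [Quotient.quot] only provides the additive group U / ker f; the scalar
   action a *: \pi x = \pi (a *: x) is added below. *)
Definition quot_ker (K : pzRingType) (U V : lmodType K)
  (f : {linear U -> V}) := Quotient.quot (ker f).

HB.instance Definition _ K U V f := GRing.Zmodule.on (@quot_ker K U V f).
HB.instance Definition _ K U V f :=
  ZmodQuotient.on (@quot_ker K U V f).

Section QuotientModule.
Context (K : pzRingType) (U V : lmodType K) (f : {linear U -> V}).
Local Notation Q := (quot_ker f).

Definition quot_map : U -> Q := \pi_Q.

Lemma quot_mapP x y : (quot_map x = quot_map y) <-> x - y \in ker f.
Proof.
rewrite Quotient.idealrBE; split=> [h|/eqP//]; exact/eqP.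
Qed.

Definition quot_scale (a : K) (q : Q) : Q := quot_map (a *: repr q).

Lemma quot_scaleE a x : quot_scale a (quot_map x) = quot_map (a *: x).
Proof.
by apply/quot_mapP; rewrite -scalerBr rpredZ //; apply/quot_mapP; exact: reprK.
Qed.

Lemma quot_mapD x y : quot_map (x + y) = quot_map x + quot_map y.
Proof. exact: raddfD. Qed.

Lemma quot_map_surj q : exists x, q = quot_map x.
Proof. by exists (repr q); rewrite /quot_map reprK. Qed.

Lemma quot_scaleA a b q : quot_scale a (quot_scale b q) = quot_scale (a * b) q.
Proof. by have [x ->] := quot_map_surj q; rewrite !quot_scaleE scalerA. Qed.

Lemma quot_scale1 : left_id 1 quot_scale.
Proof.
by move=> q; have [x ->] := quot_map_surj q; rewrite quot_scaleE scale1r.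
Qed.

Lemma quot_scaleDr : right_distributive quot_scale +%R.
Proof.
move=> a p q; have [x ->] := quot_map_surj p; have [y ->] := quot_map_surj q.
by rewrite -quot_mapD !quot_scaleE scalerDr quot_mapD.
Qed.

Lemma quot_scaleDl q : {morph quot_scale^~ q : a b / a + b}.
Proof.
move=> a b; have [x ->] := quot_map_surj q.
by rewrite !quot_scaleE scalerDl quot_mapD.
Qed.

HB.instance Definition _ := GRing.Zmodule_isLmodule.Build K Q
  quot_scaleA quot_scale1 quot_scaleDr quot_scaleDl.

Lemma quot_map_linear : linear quot_map.
Proof. by move=> a x y; rewrite quot_mapD -quot_scaleE. Qed.

HB.instance Definition _ := GRing.isLinear.Build K U Q _ quot_map
  quot_map_linear.

End QuotientModule.

Section Lift.
Context (K : pzRingType) (U V W : lmodType K).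
Context (f : {linear U -> V}) (g : {linear U -> W}).

(* The kernel inclusion is what makes the value of [g] on a representative
   independent of the choice made by [repr]: see [quot_liftE]. *)
Definition quot_lift (fg : {subset ker f <= ker g}) (q : quot_ker f) : W :=
  g (repr q).

Lemma quot_liftE fg x : quot_lift fg (quot_map f x) = g x.
Proof.
apply/eqP; rewrite -subr_eq0 -linearB -kerE; apply: fg.
by apply/quot_mapP; exact: reprK.
Qed.

Lemma quot_lift_linear fg : linear (quot_lift fg).
Proof.
move=> a p q; have [x ->] := quot_map_surj p; have [y ->] := quot_map_surj q.
by rewrite -linearP !quot_liftE linearP.
Qed.

HB.instance Definition _ fg :=
  GRing.isLinear.Build K (quot_ker f) W _ (quot_lift fg)
    (quot_lift_linear fg).

End Lift.

Definition bounded_operator (K : numFieldType) (X Y : normedModType K)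
  (T : {linear X -> Y}) : Prop :=
  exists M : K, forall x, `|T x| <= M * `|x|.

Definition argmax (K : numFieldType) (V : Type) (Y : normedModType K)
    (S T : V -> Y) : set V :=
  [set x0 | `|S x0| <= 1 /\ forall x, `|S x| <= 1 -> `|T x0| >= `|T x|].

(* Main.v *)
Require Import Defs.
From HB Require Import structures.
From mathcomp Require Import all_boot all_order all_algebra.
From mathcomp Require Import complex.
From mathcomp Require Import all_classical all_reals all_analysis.

Set Implicit Arguments.
Unset Strict Implicit.
Unset Printing Implicit Defensive.

Import Order.TTheory GRing.Theory Num.Theory.
Import numFieldNormedType.Exports.

Local Open Scope classical_set_scope.
Local Open Scope ring_scope.

(** Both operators factor through the quotient map: [Tbar] and [Sbar] take at the class of [x] the
    values [T x] and [S x] ([quot_liftE]). As every class has a representative ([quot_map_surj]),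
    the two problems have the same constraint and the same objective values, so [x0] is a maximizer
    exactly when its class is. *)

Theorem theorem4p4 (R : realType) (K : numFieldType)
    (hK : K = (R : numFieldType) \/ K = (R[i] : numFieldType))
    (X Y : completeNormedModType K) (T S : {linear X -> Y})
    (bT : bounded_operator T) (bS : bounded_operator S)
    (kerST : {subset ker S <= ker T}) :
  let Tbar : {linear quot_ker S -> Y} := quot_lift kerST in
  let Sbar : {linear quot_ker S -> Y} :=
    quot_lift (fun x (kx : x \in ker S) => kx) in
  argmax S T = quot_map S @^-1` argmax Sbar Tbar.
Proof.
move=> Tbar Sbar.
have TbarE x : Tbar (quot_map S x) = T x by exact: quot_liftE.
have SbarE x : Sbar (quot_map S x) = S x by exact: quot_liftE.
apply/seteqP; split=> x0 [Sx0 maxx0]; split.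
- by rewrite SbarE.
(* The competitor is an arbitrary class; maximality of [x0] compares only with points of [X], hence
   the choice of a representative. *)
- move=> q; have [x ->] := quot_map_surj q.
  by rewrite SbarE !TbarE; exact: maxx0.
- by rewrite -SbarE.
(* Conversely, a feasible [x] is tested through its own class, which is feasible for [Sbar]. *)
- by move=> x Sx; rewrite -!TbarE; apply: maxx0; rewrite SbarE.
Qed.
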